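(* Let $\mathcal{V}=(\mathcal{V},\otimes,k)$ be a commutative unital quantale which is completely distributive and such that $\{u\in\mathcal{V}\mid u\lll k\}$ is directed. The Hausdorff functor $\mathsf{H}\colon\mathcal{V}\text{-}\mathsf{CatCH}\to\mathcal{V}\text{-}\mathsf{CatCH}$ preserves codirected limits.
   Context: A commutative unital quantale is a complete lattice $\mathcal{V}$ with a commutative monoid structure $(\otimes,k)$ such that each $u\otimes-$ preserves suprema. The totally below relation is: $u\lll v$ iff for every $S\subseteq\mathcal{V}$ with $v\le\bigvee S$ there is $s\in S$ with $u\le s$. $\mathcal{V}$ is completely distributive iff $v=\bigvee\{u\mid u\lll v\}$ for all $v$. A $\mathcal{V}$-category $(X,a)$ is a set $X$ with $a\colon X\times X\to\mathcal{V}$ such that $k\le a(x,x)$ and $a(x,y)\otimes a(y,z)\le a(x,z)$; a $\mathcal{V}$-functor $f\colon(X,a)\to(Y,b)$ is a map with $a(x,y)\le b(f(x),f(y))$. Let $\mathsf{U}$ be the ultrafilter functor on sets; compact Hausdorff topologies on $X$ are identified with their convergence maps $\alpha\colon\mathsf{U}X\to X$. The map $\xi\colon\mathsf{U}\mathcal{V}\to\mathcal{V}$, $\xi(\mathfrak{v})=\bigwedge_{A\in\mathfrak{v}}\bigvee A$, is the convergence of a compact Hausdorff topology on $\mathcal{V}$ (the Lawson topology). For a $\mathcal{V}$-category $(X,a)$ put $\mathsf{U}(X,a)=(\mathsf{U}X,\widehat{\mathsf{U}}a)$ with $\widehat{\mathsf{U}}a(\mathfrak{x},\mathfrak{y})=\bigvee\{\xi(\mathsf{U}a(\mathfrak{w}))\mid\mathfrak{w}\in\mathsf{U}(X\times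 X),\ \mathsf{U}\pi_1(\mathfrak{w})=\mathfrak{x},\ \mathsf{U}\pi_2(\mathfrak{w})=\mathfrak{y}\}$. A $\mathcal{V}$-categorical compact Hausdorff space $(X,a,\alpha)$ is a $\mathcal{V}$-category $(X,a)$ with a compact Hausdorff topology $\alpha$ on $X$ such that $\alpha\colon\mathsf{U}(X,a)\to(X,a)$ is a $\mathcal{V}$-functor; it is known that this is equivalent to continuity of $a\colon(X,\alpha)\times(X,\alpha)\to(\mathcal{V},\xi_\le)$, where $\xi_\le$ is the topology on $\mathcal{V}$ generated by the sets $\{u\in\mathcal{V}\mid v\nleq u\}$ ($v\in\mathcal{V}$). The category $\mathcal{V}\text{-}\mathsf{CatCH}$ has these as objects and the maps that are both continuous and $\mathcal{V}$-functors as morphisms. For $A\subseteq X$ put $\uparrow\! A=\{y\mid k\le\bigvee_{x\in A}a(x,y)\}$ and $\downarrow\! A=\{y\mid k\le\bigvee_{x\in A}a(y,x)\}$. $A$ is increasing (decreasing) if $A=\uparrow\! A$ ($A=\downarrow\! A$), and co-increasing (co-decreasing) if its complement is increasing (decreasing). The Hausdorff functor $\mathsf{H}$ sends $(X,a,\alpha)$ to $\mathsf{H}X=\{A\subseteq X\mid A\text{ closed and increasing}\}$ with structure $\mathsf{H}a(A,B)=\bigwedge_{y\in B}\bigvee_{x\in A}a(x,y)$ and the hit-and-miss topology, generated by the sets $V^\Diamond=\{A\in\mathsf{H}X\mid A\cap V\neq\varnothing\}$ ($V$ open, co-increasing) and $W^\Box=\{A\in\mathsf{H}X\mid A\subseteq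 W\}$ ($W$ open, co-decreasing); it sends $f\colon X\to Y$ to $\mathsf{H}f\colon A\mapsto\uparrow\! f(A)$. (This is a well-defined endofunctor of $\mathcal{V}\text{-}\mathsf{CatCH}$.) A codirected limit is a limit of a diagram indexed by a codirected (down-directed) partially ordered set. *)

(* Defs.v *)
From HB Require Import structures.
From mathcomp Require Import all_boot all_order finmap.
From mathcomp Require Import all_classical.
From mathcomp Require Import topology.

Set Implicit Arguments.
Unset Strict Implicit.
Unset Printing Implicit Defensive.

Import Order.TTheory.
Local Open Scope order_scope.
Local Open Scope classical_set_scope.

HB.mixin Record POrder_isCompleteLattice d T & Order.POrder d T := {
  bigsup : set T -> T;
  bigsupP : forall A : set T, supremums A (bigsup A)
}.

#[short(type="completeLatticeType")]
HB.structure Definition CompleteLattice d :=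
  {T of Order.POrder d T & POrder_isCompleteLattice d T}.

Definition biginf d (T : completeLatticeType d) (A : set T) : T :=
  bigsup (lbound A).

HB.mixin Record CompleteLattice_isQuantale d V & CompleteLattice d V := {
  tensor : V -> V -> V;
  qunit : V;
  tensorA : associative tensor;
  tensorC : commutative tensor;
  tensor1q : left_id qunit tensor;
  tensor_bigsup : forall (u : V) (S : set V),
    tensor u (bigsup S) = bigsup (tensor u @` S)
}.

#[short(type="quantaleType")]
HB.structure Definition Quantale d :=
  {V of CompleteLattice d V & CompleteLattice_isQuantale d V}.

Definition directed d (T : porderType d) (D : set T) :=
  D !=set0 /\
  forall u v, D u -> D v -> exists2 w, D w & (u <= w) /\ (v <= w).

Definition codirected d (I : porderType d) :=
  [set: I] !=set0 /\ forall i j : I, exists2 l : I, l <= i & l <= j.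

Definition totally_below d (V : completeLatticeType d) (u v : V) :=
  forall S : set V, v <= bigsup S -> exists2 s, S s & u <= s.

Definition completely_distributive d (V : completeLatticeType d) :=
  forall v : V, v = bigsup [set u | totally_below u v].

Section VCategories.
Context {d : Order.disp_t} {V : quantaleType d}.

Definition is_vcategory (X : Type) (a : X -> X -> V) :=
  (forall x, qunit <= a x x) /\
  (forall x y z, tensor (a x y) (a y z) <= a x z).

Definition is_vfunctor (X Y : Type) (a : X -> X -> V) (b : Y -> Y -> V)
    (f : X -> Y) :=
  forall x y, a x y <= b (f x) (f y).

Definition up (X : Type) (a : X -> X -> V) (A : set X) : set X :=
  [set y | qunit <= bigsup [set a x y | x in A]].

Definition down (X : Type) (a : X -> X -> V) (A : set X) : set X :=
  [set y | qunit <= bigsup [set a y x | x in A]].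

Definition increasing (X : Type) (a : X -> X -> V) (A : set X) := A = up a A.
Definition decreasing (X : Type) (a : X -> X -> V) (A : set X) := A = down a A.
Definition co_increasing (X : Type) (a : X -> X -> V) (A : set X) :=
  increasing a (~` A).
Definition co_decreasing (X : Type) (a : X -> X -> V) (A : set X) :=
  decreasing a (~` A).

End VCategories.

Record ultrafilter (X : Type) := Ultrafilter {
  uset :> set_system X;
  usetP : UltraFilter uset
}.
#[global] Existing Instance usetP.

Lemma fmap_ultra (X Y : Type) (f : X -> Y) (F : set_system X) :
  UltraFilter F -> UltraFilter (fmap f F).
Proof.
move=> UF; split; first exact: fmap_proper_filter.
move=> G PG FG; rewrite predeqE => B; split; last exact: FG.
move=> GB; have [//|FnB] := in_ultra_setVsetC (f @^-1` B) UF.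
have /FG GnB : fmap f F (~` B) by exact: FnB.
by have /filter_ex [y []] : G (B `&` ~` B) by exact: filterI.
Qed.

Definition umap (X Y : Type) (f : X -> Y) (F : ultrafilter X) :
  ultrafilter Y := Ultrafilter (fmap_ultra f (usetP F)).

Section UltrafilterExtension.
Context {d : Order.disp_t} {V : quantaleType d}.

Definition xi (F : ultrafilter V) : V :=
  biginf [set bigsup A | A in (F : set_system V)].

Definition uhat (X : Type) (a : X -> X -> V) (F G : ultrafilter X) : V :=
  bigsup [set xi (umap (fun p : X * X => a p.1 p.2) w) |
    w in [set w : ultrafilter (X * X) | umap fst w = F /\ umap snd w = G]].

End UltrafilterExtension.

Lemma ultra_cvg_ex (X : topologicalType) (cX : compact [set: X])
  (F : ultrafilter X) : {x : X | uset F --> x}.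
Proof.
apply: cid; move: cX; rewrite compact_ultra => /(_ F (usetP F) filterT).
by case=> x [_ Fx]; exists x.
Qed.

(* The convergence map; the chosen limit is the only one when X is Hausdorff,
   see convergence_eq. *)
Definition convergence (X : topologicalType) (cX : compact [set: X])
  (F : ultrafilter X) : X := sval (ultra_cvg_ex cX F).

Record vcatch d (V : quantaleType d) := VCatCH {
  vcarrier :> topologicalType;
  vhom : vcarrier -> vcarrier -> V;
  vhom_vcategory : is_vcategory vhom;
  vcarrier_compact : compact [set: vcarrier];
  vcarrier_hausdorff : hausdorff_space vcarrier;
  convergence_vfunctor :
    is_vfunctor (uhat vhom) vhom (convergence vcarrier_compact)
}.
Arguments vhom {d V v}.
Arguments vhom_vcategory {d V} v.
Arguments vcarrier_compact {d V} v.
Arguments vcarrier_hausdorff {d V} v.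
Arguments convergence_vfunctor {d V} v.

Record vcatch_hom d (V : quantaleType d) (X Y : vcatch V) := VCatCHHom {
  hom_fun :> X -> Y;
  hom_continuous : continuous hom_fun;
  hom_vfunctor : is_vfunctor vhom vhom hom_fun
}.

Arguments hom_continuous {d V X Y} _.
Arguments hom_vfunctor {d V X Y} _.

Record category := Category {
  obj :> Type;
  hom : obj -> obj -> Type;
  idm : forall X, hom X X;
  comp : forall X Y Z, hom Y Z -> hom X Y -> hom X Z;
  comp_idl : forall X Y (f : hom X Y), comp (idm Y) f = f;
  comp_idr : forall X Y (f : hom X Y), comp f (idm X) = f;
  compA : forall W X Y Z (h : hom Y Z) (g : hom X Y) (f : hom W X),
    comp h (comp g f) = comp (comp h g) f
}.
Arguments hom {c} _ _.
Arguments idm {c} X.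
Arguments comp {c X Y Z} _ _.

Record functor (C D : category) := Functor {
  fobj :> C -> D;
  fmor : forall X Y : C, hom X Y -> hom (fobj X) (fobj Y);
  fmor_id : forall X : C, fmor (idm X) = idm (fobj X);
  fmor_comp : forall (X Y Z : C) (g : hom Y Z) (f : hom X Y),
    fmor (comp g f) = comp (fmor g) (fmor f)
}.
Arguments fmor {C D} _ {X Y} _.

Definition functor_comp (B C D : category) (G : functor C D) (F : functor B C) :
  functor B D.
Proof.
refine (@Functor B D (fun X => G (F X)) (fun X Y f => fmor G (fmor F f)) _ _).
- by move=> X; rewrite !fmor_id.
- by move=> X Y Z g f; rewrite !fmor_comp.
Defined.

Record cone (J C : category) (D : functor J C) := Cone {
  apex : C;
  leg : forall j : J, hom apex (D j);
  leg_natural : forall (i j : J) (f : hom i j), comp (fmor D f) (leg i) = leg j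
}.
Arguments apex {J C D} _.
Arguments leg {J C D} _ _.

Definition is_limit (J C : category) (D : functor J C) (c : cone D) :=
  forall c' : cone D,
    exists! h : hom (apex c') (apex c), forall j, comp (leg c j) h = leg c' j.

Definition cone_image (J C C' : category) (F : functor C C') (D : functor J C)
  (c : cone D) : cone (functor_comp F D).
Proof.
refine (@Cone _ _ (functor_comp F D) (F (apex c)) (fun j => fmor F (leg c j)) _).
by move=> i j f /=; rewrite -fmor_comp leg_natural.
Defined.

(* One arrow i -> j when i <= j, so that a functor out of it is a diagram whose
   connecting maps go upwards, and a codirected limit has a codirected index. *)
Definition poset_category d (I : porderType d) : category.
Proof.
refine (@Category I (fun i j => i <= j) (fun i => lexx i)
  (fun i j l (jl : j <= l) (ij : i <= j) => le_trans ij jl) _ _ _).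
- by move=> *; exact: bool_irrelevance.
- by move=> *; exact: bool_irrelevance.
- by move=> *; exact: bool_irrelevance.
Defined.

Definition preserves_codirected_limits (C C' : category) (F : functor C C') :=
  forall (d : Order.disp_t) (I : porderType d)
    (D : functor (poset_category I) C) (c : cone D),
    codirected I -> is_limit c -> is_limit (cone_image F c).

Section VCatCH.
Context {d : Order.disp_t} {V : quantaleType d}.
Implicit Types X Y Z : vcatch V.

Lemma vcatch_hom_eq X Y (f g : vcatch_hom X Y) : f =1 g -> f = g.
Proof.
case: f g => [f fc fv] [g gc gv] /= /funext fg; move: fc fv gc gv.
by rewrite fg => *; congr VCatCHHom; exact: Prop_irrelevance.
Qed.

Definition vcatch_id X : vcatch_hom X X.
Proof. by refine (@VCatCHHom _ _ X X id _ _) => // x; exact: cvg_id. Defined.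

Definition vcatch_comp X Y Z (g : vcatch_hom Y Z) (f : vcatch_hom X Y) :
  vcatch_hom X Z.
Proof.
refine (@VCatCHHom _ _ X Z (g \o f) _ _).
- by move=> x; apply: continuous_comp; exact: hom_continuous.
- move=> x y; apply: (le_trans (hom_vfunctor f x y)); exact: hom_vfunctor.
Defined.

Definition VCatCHCategory : category.
Proof.
refine (@Category (vcatch V) (@vcatch_hom d V) vcatch_id vcatch_comp _ _ _).
- by move=> *; exact: vcatch_hom_eq.
- by move=> *; exact: vcatch_hom_eq.
- by move=> *; exact: vcatch_hom_eq.
Defined.

End VCatCH.
Arguments VCatCHCategory {d} V.

Record hausdorff_set d (V : quantaleType d) (X : vcatch V) := HausdorffSet {
  hset :> set X;
  hset_closed : closed hset;
  hset_increasing : increasing vhom hset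
}.

Arguments hset_closed {d V X} _.
Arguments hset_increasing {d V X} _.

Section HausdorffData.
Context {d : Order.disp_t} {V : quantaleType d} (X : vcatch V).

Definition hausdorff_hom (A B : hausdorff_set X) : V :=
  biginf [set bigsup [set vhom x y | x in (A : set X)] | y in (B : set X)].

Definition hit (U : set X) : set (hausdorff_set X) :=
  [set A | (A : set X) `&` U !=set0].
Definition miss (U : set X) : set (hausdorff_set X) :=
  [set A | (A : set X) `<=` U].

Definition hit_miss_subbase : set (set (hausdorff_set X)) :=
  [set hit U | U in [set U | open U /\ co_increasing vhom U]] `|`
  [set miss U | U in [set U | open U /\ co_decreasing vhom U]].

HB.instance Definition _ := gen_eqMixin (hausdorff_set X).
HB.instance Definition _ := gen_choiceMixin (hausdorff_set X).
HB.instance Definition _ :=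
  isSubBaseTopological.Build (hausdorff_set X) hit_miss_subbase id.

End HausdorffData.

Section LatticeTheory.
Context {d : Order.disp_t} {T : completeLatticeType d}.
Implicit Types (A : set T) (u v w : T).

Lemma bigsup_ub A u : A u -> u <= bigsup A.
Proof. by have [h _] := bigsupP A; exact: h. Qed.

Lemma bigsup_le A u : (forall v, A v -> v <= u) -> bigsup A <= u.
Proof. by move=> Au; have [_] := bigsupP A; apply. Qed.

Lemma bigsup_image_ub (I : Type) (A : set I) (f : I -> T) i :
  A i -> f i <= bigsup [set f x | x in A].
Proof. by move=> Ai; apply: bigsup_ub; exists i. Qed.

Lemma bigsup_image_le (I : Type) (A : set I) (f : I -> T) u :
  (forall i, A i -> f i <= u) -> bigsup [set f x | x in A] <= u.
Proof. by move=> Au; apply: bigsup_le => _ [i Ai <-]; exact: Au. Qed.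

Lemma biginf_lb A u : A u -> biginf A <= u.
Proof. by move=> Au; apply: bigsup_le => v; apply. Qed.

Lemma biginf_ge A u : (forall v, A v -> u <= v) -> u <= biginf A.
Proof. by move=> Au; exact: bigsup_ub. Qed.

Lemma biginf_image_ge (I : Type) (A : set I) (f : I -> T) u :
  (forall i, A i -> u <= f i) -> u <= biginf [set f x | x in A].
Proof. by move=> Au; apply: biginf_ge => _ [i Ai <-]; exact: Au. Qed.

Lemma biginf_image_lb (I : Type) (A : set I) (f : I -> T) i :
  A i -> biginf [set f x | x in A] <= f i.
Proof. by move=> Ai; apply: biginf_lb; exists i. Qed.

Lemma totally_below_le u v : totally_below u v -> u <= v.
Proof. by move=> /(_ [set v]) [|_ -> //]; exact: bigsup_ub. Qed.

Lemma totally_below_lew u v w : totally_below u v -> v <= w -> totally_below u w.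
Proof. by move=> uv vw S wS; apply: uv; exact: le_trans wS. Qed.

Lemma cd_le u v : completely_distributive T ->
  (forall w, totally_below w u -> w <= v) -> u <= v.
Proof. by move=> cd uv; rewrite (cd u); exact: bigsup_le. Qed.

Lemma cd_nle u v : completely_distributive T -> ~ (u <= v) ->
  exists2 w, totally_below w u & ~ (w <= v).
Proof.
move=> cd; apply: contra_notP => h; apply: cd_le => // w wu.
by apply: contrapT => wv; apply: h; exists w.
Qed.

End LatticeTheory.

Section QuantaleTheory.
Context {d : Order.disp_t} {V : quantaleType d}.
Implicit Types u v w : V.

Lemma tensorq1 u : tensor u qunit = u.
Proof. by rewrite tensorC tensor1q. Qed.

Lemma tensor_le u v w : v <= w -> tensor u v <= tensor u w.
Proof.
move=> vw; have -> : w = bigsup [set v; w].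
  apply/le_anti/andP; split; first by apply: bigsup_ub; right.
  by apply: bigsup_le => _ [->|->].
by rewrite tensor_bigsup; apply: bigsup_ub; exists v => //; left.
Qed.

Lemma tensor_le2 u u' v v' : u <= u' -> v <= v' -> tensor u v <= tensor u' v'.
Proof.
move=> uu' vv'; apply: (le_trans (tensor_le u vv')).
by rewrite ![tensor _ v']tensorC; exact: tensor_le.
Qed.

Lemma tensor_bigsup_le (I : Type) (A : set I) (f : I -> V) u v :
  (forall i, A i -> tensor u (f i) <= v) ->
  tensor u (bigsup [set f x | x in A]) <= v.
Proof. by move=> h; rewrite tensor_bigsup; apply: bigsup_le => _ [_ [i Ai <-] <-]; exact: h. Qed.

End QuantaleTheory.

Section VCategoryTheory.
Context {d : Order.disp_t} {V : quantaleType d} {X : Type} {a : X -> X -> V}.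
Hypothesis aV : is_vcategory a.
Implicit Types A B : set X.

Let op_vcat : is_vcategory (fun x y => a y x).
Proof. by case: aV => r t; split => // x y z; rewrite tensorC. Qed.

Lemma sub_up A : A `<=` up a A.
Proof. by move=> x Ax; apply: (le_trans (aV.1 x)); apply: bigsup_ub; exists x. Qed.

Lemma upS A B : A `<=` B -> up a A `<=` up a B.
Proof.
move=> AB x Ax; apply: (le_trans Ax); apply: bigsup_image_le => y Ay.
by apply: bigsup_ub; exists y => //; exact: AB.
Qed.

Lemma up_le A x y : A x -> qunit <= a x y -> up a A y.
Proof. by move=> Ax xy; apply: (le_trans xy); apply: bigsup_ub; exists x. Qed.

(* Enlarging A to its increasing hull does not change suprema of a(-, y). *)
Lemma bigsup_up A y :
  bigsup [set a x y | x in up a A] <= bigsup [set a x y | x in A].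
Proof.
apply: bigsup_image_le => x Ax; rewrite -[a x y]tensorq1.
apply: (le_trans (tensor_le _ Ax)); apply: tensor_bigsup_le => z Az.
rewrite tensorC; apply: (le_trans (aV.2 _ _ _)).
by apply: bigsup_ub; exists z.
Qed.

Lemma up_increasing A : increasing a (up a A).
Proof.
apply/seteqP; split; first exact: sub_up.
by move=> y Ay; apply: (le_trans Ay); exact: bigsup_up.
Qed.

Lemma vle_left x y z : qunit <= a x y -> a y z <= a x z.
Proof.
move=> xy; apply: le_trans (aV.2 x y z).
rewrite -{1}[a y z]tensor1q; exact: tensor_le2.
Qed.

Lemma vle_right x y z : qunit <= a y z -> a x y <= a x z.
Proof.
move=> yz; apply: le_trans (aV.2 x y z).
by rewrite -{1}[a x y]tensorq1; exact: tensor_le2.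
Qed.

Lemma vle_trans x y z : qunit <= a x y -> qunit <= a y z -> qunit <= a x z.
Proof. by move=> xy yz; apply: (le_trans yz); exact: vle_left. Qed.

Lemma vcategory_op : is_vcategory (fun x y => a y x).
Proof. exact: op_vcat. Qed.

End VCategoryTheory.

Lemma preimage_up_sub d (V : quantaleType d) (X Y : Type) (a : X -> X -> V)
    (b : Y -> Y -> V) (f : X -> Y) (B : set Y) : is_vcategory a ->
  is_vfunctor a b f -> increasing b B -> increasing a (f @^-1` B).
Proof.
move=> aV fV Binc; apply/seteqP; split; first exact: sub_up.
move=> x Bx; rewrite /preimage /= Binc; apply: (le_trans Bx).
apply: bigsup_image_le => y By; apply: (le_trans (fV _ _)).
by apply: bigsup_ub; exists (f y).
Qed.

Lemma closed_ultraP (T : topologicalType) (A : set T) :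
  (forall (F : ultrafilter T) x, uset F A -> uset F --> x -> A x) -> closed A.
Proof.
move=> h x; rewrite closureEcvg /= => -[F PF [Fx sF]].
have [G [UG FG]] := ultraFilterLemma PF.
apply: (h (Ultrafilter UG)) => /=; first by apply/FG/sF.
exact: subset_trans Fx FG.
Qed.

Lemma convergenceP (X : topologicalType) (cX : compact [set: X])
  (F : ultrafilter X) : uset F --> convergence cX F.
Proof. exact: (svalP (ultra_cvg_ex cX F)). Qed.

Lemma convergence_eq (X : topologicalType) (cX : compact [set: X])
    (F : ultrafilter X) x :
  hausdorff_space X -> uset F --> x -> convergence cX F = x.
Proof.
move=> hX Fx; apply: hX => A B /convergenceP FA /Fx FB.
have UF := usetP F; exact: (@filter_ex _ (uset F)) (filterI FA FB).
Qed.

Section VhomClosed.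
Context {d : Order.disp_t} {V : quantaleType d} (X : topologicalType).
Variables (cX : compact [set: X]) (hX : hausdorff_space X).
Variable a : X -> X -> V.

Lemma vhom_closed_of : is_vfunctor (uhat a) a (convergence cX) ->
  forall v, closed [set p : X * X | v <= a p.1 p.2].
Proof.
move=> aF v; apply: closed_ultraP => w [x y] wv wxy /=.
have wx : uset (umap fst w) --> x by move=> A Ax; apply: (wxy (fst @^-1` A)); exact: cvg_fst.
have wy : uset (umap snd w) --> y by move=> A Ay; apply: (wxy (snd @^-1` A)); exact: cvg_snd.
rewrite -(convergence_eq cX hX wx) -(convergence_eq cX hX wy).
apply: le_trans (aF _ _).
apply: (@le_trans _ _ (xi (umap (fun p : X * X => a p.1 p.2) w))); last first.
  by apply: bigsup_ub; exists w.
apply: biginf_image_ge => B wB; have UF := usetP w.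
have [p [/= ? ?]] := @filter_ex _ (uset w) _ _ (filterI wv wB).
apply: (@le_trans _ _ (a p.1 p.2)) => //; exact: bigsup_ub.
Qed.

Lemma vhom_closed_to : completely_distributive V ->
  (forall v, closed [set p : X * X | v <= a p.1 p.2]) ->
  is_vfunctor (uhat a) a (convergence cX).
Proof.
move=> cd aC F G; apply: bigsup_image_le => w /= [wF wG].
have wc : uset w --> (convergence cX F, convergence cX G).
  move=> N [[P Q] [/= FP GQ] PQN]; have UF := usetP w.
  have wP : uset (umap fst w) P by rewrite wF; exact: convergenceP FP.
  have wQ : uset (umap snd w) Q by rewrite wG; exact: convergenceP GQ.
  by apply: filterS PQN _; exact: (@filterI _ (uset w) _ _ _ wP wQ).
apply: cd_le => // u uxi.
apply: (aC u (_, _)) => N /wc wN.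
have UF := usetP w.
have [|wn] := in_ultra_setVsetC [set p : X * X | u <= a p.1 p.2] UF.
  by move=> wu; exact: (@filter_ex _ (uset w)) (filterI wu wN).
exfalso.
have : totally_below u (bigsup [set v | ~ (u <= v)]).
  apply: (totally_below_lew uxi); apply: biginf_lb; exists [set v | ~ (u <= v)] => //.
by move=> /(_ _ (lexx _)) [v].
Qed.

End VhomClosed.

Section Separation.
Context {d : Order.disp_t} {V : quantaleType d} (X : topologicalType).
Variables (cX : compact [set: X]) (hX : hausdorff_space X).
Variable a : X -> X -> V.
Hypothesis aV : is_vcategory a.
Hypothesis aC : forall v, closed [set p : X * X | v <= a p.1 p.2].
Hypothesis cd : completely_distributive V.
Hypothesis dir : directed [set u : V | totally_below u qunit].

Let closed_near_covering (A : set X) : closed A -> near_covering A.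
Proof. by move=> Ac; apply/compact_near_coveringP; exact: subclosed_compact cX _. Qed.

Lemma nle_near u x y : ~ (u <= a x y) ->
  \forall x' \near x & y' \near y, ~ (u <= a x' y').
Proof.
move=> uxy; have : open (~` [set p : X * X | u <= a p.1 p.2]).
  exact: closed_openC.
by rewrite openE => /(_ (x, y)); apply.
Qed.

Lemma open_nle (A : set X) u : closed A ->
  open [set y | forall x, A x -> ~ (u <= a x y)].
Proof.
move=> /closed_near_covering Ac; rewrite openE => y Ay.
by apply: (Ac X (nbhs y) (fun y' x => ~ (u <= a x y'))) => x /Ay /nle_near.
Qed.

Lemma up_closed (A : set X) : closed A -> closed (up a A).
Proof.
move=> Ac; rewrite -openC openE => y /= /(cd_nle cd)[u uk uA].
have : nbhs y [set y | forall x, A x -> ~ (u <= a x y)].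
  have := open_nle u Ac; rewrite openE; apply => x Ax ux; apply: uA.
  by apply: (le_trans ux); apply: bigsup_ub; exists x.
by apply: filterS => z /= zA /uk[_ [x Ax <-]]; exact: zA.
Qed.

Lemma up_point (A : set X) y : closed A -> up a A y ->
  exists2 x, A x & qunit <= a x y.
Proof.
move=> /closed_near_covering Ac Ay; apply: contrapT => h.
pose tail (u : V) := [set w : V | totally_below w qunit /\ u <= w].
have [[u0 u0k] dirk] := dir.
pose F := filter_from [set u : V | totally_below u qunit] tail.
have FF : Filter F.
  apply: filter_from_filter; first by exists u0.
  move=> u v uk vk; have [w wk [uw vw]] := dirk _ _ uk vk.
  by exists w => // z [zk wz]; split; split => //; exact: le_trans wz.
have [u uk uA] : \near F, A `<=` (fun u x => ~ (u <= a x y)) F.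
  apply: Ac => x Ax.
  have [|u uk ux] := @cd_nle _ _ qunit (a x y) cd.
    by move=> kx; apply: h; exists x.
  have [[P Q] /= [xP yQ] PQ] := nle_near ux.
  exists (P, tail u) => /=; first by split => //; exists u.
  move=> [x' w] /= [Px' [_ uw]] wx'.
  apply: (PQ (x', y)) => /=; first by split => //; exact: nbhs_singleton.
  exact: le_trans wx'.
have [|_ [x Ax <-]] := uk [set a x y | x in A]; first exact: Ay.
by apply: uA Ax; split.
Qed.

End Separation.

Section Separation2.
Context {d : Order.disp_t} {V : quantaleType d} (X : topologicalType).
Variables (cX : compact [set: X]) (hX : hausdorff_space X).
Variable a : X -> X -> V.
Hypothesis aV : is_vcategory a.
Hypothesis aC : forall v, closed [set p : X * X | v <= a p.1 p.2].
Hypothesis cd : completely_distributive V.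
Hypothesis dir : directed [set u : V | totally_below u qunit].

Let aVop : is_vcategory (fun x y => a y x) := vcategory_op aV.

Let aCop v : closed [set p : X * X | v <= a p.2 p.1].
Proof.
exact: ((continuous_closedP _).1 swap_continuous _ (@aC v)).
Qed.

Lemma down_closed (A : set X) : closed A -> closed (down a A).
Proof. exact: (@up_closed _ _ _ cX (fun x y => a y x) (@aCop) cd). Qed.

Lemma down_point (A : set X) y : closed A -> down a A y ->
  exists2 x, A x & qunit <= a y x.
Proof. exact: (@up_point _ _ _ cX (fun x y => a y x) (@aCop) cd dir). Qed.

Lemma co_increasing_upC (A : set X) : co_increasing a (~` up a A).
Proof. by rewrite /co_increasing setCK; exact: up_increasing. Qed.

Lemma co_decreasing_downC (A : set X) : co_decreasing a (~` down a A).
Proof. by rewrite /co_decreasing setCK; exact: (up_increasing aVop). Qed.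

Lemma separation (A : set X) u y : closed A -> increasing a A ->
  (forall x, A x -> ~ (u <= a x y)) ->
  exists W U : set X, [/\ open W /\ co_decreasing a W, open U /\ co_increasing a U,
    A `<=` W, U y & forall w z, W w -> U z -> ~ (u <= a w z)].
Proof.
move=> Ac Ainc uA; pose L := down a [set y].
have Lc : closed L by apply: down_closed; apply: (@compact_closed X); [exact: hX|exact: compact_set1].
have Lu x z : A x -> L z -> ~ (u <= a x z).
  move=> Ax; rewrite /L /down /= image_set1 => zy ux; apply: (uA x) => //.
  apply: (le_trans ux); apply: (vle_right aV).
  by apply: (le_trans zy); apply: bigsup_le => _ ->.
have /(compact_normal hX cX Ac) [B AB BL] :
    set_nbhs A [set x | forall z, L z -> ~ (u <= a x z)].
  have Uo := @open_nle _ _ _ cX (fun x y => a y x) (@aCop) _ u Lc.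
  by move=> x Ax; apply: (open_nbhs_nbhs (conj Uo _)) => z Lz; exact: Lu.
pose W0 := B°; pose V0 := [set z | forall x, closure B x -> ~ (u <= a x z)].
have W0o : open W0 by exact: open_interior.
have V0o : open V0 by exact: (open_nle cX (@aC) u (@closed_closure _ B)).
exists (~` down a (~` W0)), (~` up a (~` V0)); split.
- split; last exact: co_decreasing_downC.
  by apply: closed_openC; apply: down_closed; exact: open_closedC.
- split; last exact: co_increasing_upC.
  by apply: closed_openC; apply: (up_closed cX (@aC) cd); exact: open_closedC.
- move=> x Ax /= /(down_point (open_closedC W0o))[z W0z xz]; apply: W0z.
  by apply: AB; rewrite Ainc; exact: up_le xz.
- move=> /= /(up_point cX (@aC) cd dir (open_closedC V0o))[z V0z zy]; apply: V0z.
  by move=> x /BL; apply; rewrite /L; exact: (@up_le _ _ _ (fun x y => a y x)) zy.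
- move=> w z Ww Uz.
  have W0w : W0 w by apply: contrapT => h; apply: Ww; exact: (sub_up aVop).
  have V0z : V0 z by apply: contrapT => h; apply: Uz; exact: (sub_up aV).
  by apply: V0z; apply: subset_closure; exact: interior_subset W0w.
Qed.

End Separation2.

Section HitMiss.
Context {d : Order.disp_t} {V : quantaleType d} (X : vcatch V).
Implicit Types A B : hausdorff_set X.

Lemma hausdorff_set_eq A B : (A : set X) = B -> A = B.
Proof.
case: A B => [A Ac Ai] [B Bc Bi] /= AB; move: Bc Bi; rewrite -AB => Bc Bi.
by congr HausdorffSet; exact: Prop_irrelevance.
Qed.

Lemma hit_miss_open (U : set (hausdorff_set X)) : hit_miss_subbase U -> open U.
Proof.
move=> sU; exists [set U]; last by rewrite bigcup_set1.
move=> _ ->; exists [fset U]%fset; first by move=> W; rewrite inE inE => /eqP ->.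
by rewrite set_fset1 bigcap_set1.
Qed.

Lemma hit_open (U : set X) : open U -> co_increasing vhom U -> open (hit U).
Proof. by move=> Uo Ui; apply: hit_miss_open; left; exists U. Qed.

Lemma miss_open (U : set X) : open U -> co_decreasing vhom U -> open (miss U).
Proof. by move=> Uo Ui; apply: hit_miss_open; right; exists U. Qed.

Lemma hausdorff_cvg (F : set_system (hausdorff_set X)) A : Filter F ->
  (forall U, open U -> co_increasing vhom U -> hit U A -> F (hit U)) ->
  (forall U, open U -> co_decreasing vhom U -> miss U A -> F (miss U)) ->
  F --> A.
Proof.
move=> FF Fhit Fmiss N; rewrite /= nbhsE => -[_ [[B sB <-] [C BC CA]] BN].
apply: filterS BN _; apply: (@filterS _ _ _ C); first by move=> ? ?; exists C.
have /sB [D sD IDC] := BC; rewrite -IDC; apply: filter_bigI => E DE.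
have EA : E A by move: CA; rewrite -IDC => /(_ _ DE).
have /sD := DE; rewrite inE => -[[U [Uo Ui] UE]|[U [Uo Ui] UE]].
  by move: EA; rewrite -UE /=; exact: Fhit.
by move: EA; rewrite -UE /=; exact: Fmiss.
Qed.

End HitMiss.

Section HausdorffObject.
Context {d : Order.disp_t} {V : quantaleType d}.
Hypothesis cd : completely_distributive V.
Hypothesis dir : directed [set u : V | totally_below u qunit].

Lemma vhom_closed (X : vcatch V) v :
  closed [set p : X * X | v <= vhom p.1 p.2].
Proof.
exact: (@vhom_closed_of _ _ _ _ (vcarrier_hausdorff X) _ (convergence_vfunctor X) v).
Qed.

Section Object.
Variable X : vcatch V.
Let aV := vhom_vcategory X.
Let cX := vcarrier_compact X.
Let hX := vcarrier_hausdorff X.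
Let aC := @vhom_closed X.
Implicit Types A B : hausdorff_set X.

Definition hausdorff_up (A : set X) (Ac : closed A) : hausdorff_set X :=
  HausdorffSet (up_closed cX (@aC) cd Ac) (up_increasing aV A).

Lemma hausdorff_vcategory : is_vcategory (@hausdorff_hom _ _ X).
Proof.
split=> [A|A B C].
  apply: biginf_image_ge => y Ay; exact: (sub_up aV).
apply: biginf_image_ge => z Cz.
apply: (le_trans (tensor_le _ (biginf_image_lb _ Cz))).
apply: tensor_bigsup_le => y By; rewrite tensorC.
apply: (le_trans (tensor_le _ (biginf_image_lb _ By))).
apply: tensor_bigsup_le => x Ax; rewrite tensorC.
by apply: (le_trans (aV.2 _ _ _)); apply: bigsup_ub; exists x.
Qed.

Lemma hausdorff_compact : compact [set: hausdorff_set X].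
Proof.
rewrite compact_ultra => F UF _.
pose L := [set x : X | forall N, nbhs x N -> F (hit N)].
have Lc : closed L.
  rewrite -openC openE => x /= /existsNP[N /not_implyP[xN FN]].
  have := nbhs_interior xN; apply: filterS => y yN Ly; apply: FN; exact: Ly.
exists (hausdorff_up Lc); split => //.
apply: hausdorff_cvg => U Uo Ui.
  case=> y [Ly Uy]; suff [x [Lx Ux]] : exists x, L x /\ U x.
    by apply: Lx; exact: open_nbhs_nbhs.
  apply: contrapT => LU; suff : (~` U) y by [].
  by rewrite Ui; apply: upS Ly => x Lx Ux; apply: LU; exists x.
move=> LU; have [//|FnU] := in_ultra_setVsetC (miss U) UF; exfalso.
have /compact_near_coveringP cU : compact (~` U).
  by apply: subclosed_compact cX _ => //; exact: open_closedC.
have : \forall A \near F, ~` U `<=` (fun (A : hausdorff_set X) x => ~ (A : set X) x) A.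
  apply: cU => x Ux; have : ~ L x by move=> Lx; apply/Ux/LU; exact: (sub_up aV).
  move=> /existsNP[N /not_implyP[xN FN]].
  have [//|FnN] := in_ultra_setVsetC (hit N) UF.
  by exists (N, ~` hit N) => //= -[y A] /= [Ny AN] Ay; apply: AN; exists y.
move=> FU; have [A [AnU AU]] := filter_ex (filterI FnU FU).
by apply: AnU => x Ax; apply: contrapT => Ux; exact: AU Ux Ax.
Qed.

Lemma hausdorff_hausdorff : hausdorff_space (hausdorff_set X).
Proof.
suff h A B : cluster (nbhs A) B -> (B : set X) `<=` A.
  move=> A B AB; apply: hausdorff_set_eq; apply/seteqP; split; last exact: h.
  by apply: h => P Q BP AQ; rewrite setIC; exact: AB.
move=> AB y By; apply: contrapT => Ay.
have [|u uk uA] := @cd_nle _ _ qunit (bigsup [set vhom x y | x in (A : set X)]) cd.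
  by move=> ky; apply: Ay; rewrite (hset_increasing A).
have [x Ax|W [U [[Wo Wd] [Uo Ui] AW Uy WU]]] :=
    @separation _ _ _ cX hX _ aV (@aC) cd dir _ u y (hset_closed A) (hset_increasing A).
  by move=> ux; apply: uA; apply: (le_trans ux); apply: bigsup_ub; exists x.
have [||C [CW [x [Cx Ux]]]] := AB (miss W) (hit U).
- by apply: open_nbhs_nbhs; split; first exact: miss_open.
- by apply: open_nbhs_nbhs; split; [exact: hit_open|exists y].
- by apply: (WU x x) => //; [exact: CW|exact: le_trans (totally_below_le uk) (aV.1 x)].
Qed.

Lemma hausdorff_vfunctor : is_vfunctor (uhat (@hausdorff_hom _ _ X))
  (@hausdorff_hom _ _ X) (convergence hausdorff_compact).
Proof.
apply: vhom_closed_to => // v; rewrite -openC openE => -[A B] /= vAB.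
have [y By vy] : exists2 y, (B : set X) y &
    ~ (v <= bigsup [set vhom x y | x in (A : set X)]).
  apply: contrapT => h; apply: vAB; apply: biginf_image_ge => y By.
  by apply: contrapT => vy; apply: h; exists y.
have [u uv uA] := cd_nle cd vy.
have [x Ax|W [U [[Wo Wd] [Uo Ui] AW Uy WU]]] :=
    @separation _ _ _ cX hX _ aV (@aC) cd dir _ u y (hset_closed A) (hset_increasing A).
  by move=> ux; apply: uA; apply: (le_trans ux); apply: bigsup_ub; exists x.
exists (miss W, hit U) => /=; first split.
- by apply: open_nbhs_nbhs; split; first exact: miss_open.
- by apply: open_nbhs_nbhs; split; [exact: hit_open|exists y].
move=> [A' B'] /= [AW' [z [Bz Uz]]] vAB'.
have /uv [_ [x Ax <-]] := le_trans vAB' (biginf_image_lb _ Bz).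
by apply: WU Uz; exact: AW'.
Qed.

Definition hausdorff_obj : vcatch V :=
  VCatCH hausdorff_vcategory hausdorff_hausdorff hausdorff_vfunctor.

End Object.

Section Morphism.
Variables (X Y : vcatch V) (f : vcatch_hom X Y).

Lemma image_closed (A : set X) : closed A -> closed (f @` A).
Proof.
move=> Ac; apply: (@compact_closed Y); first exact: vcarrier_hausdorff.
apply: continuous_compact.
  by apply: continuous_subspaceT; exact: hom_continuous.
exact: subclosed_compact (vcarrier_compact X) _.
Qed.

Definition hausdorff_map (A : hausdorff_obj X) : hausdorff_obj Y :=
  hausdorff_up (image_closed (hset_closed A)).

Lemma hausdorff_map_vfunctor : is_vfunctor vhom vhom hausdorff_map.
Proof.
move=> A B; apply: biginf_image_ge => y fBy.
rewrite -[vhom A B]tensorq1; apply: (le_trans (tensor_le _ fBy)).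
apply: tensor_bigsup_le => _ [x Bx <-]; rewrite tensorC.
apply: (le_trans (tensor_le _ (biginf_image_lb _ Bx))).
apply: tensor_bigsup_le => z Az; rewrite tensorC.
apply: (le_trans (tensor_le2 (hom_vfunctor f z x) (lexx _))).
apply: (le_trans ((vhom_vcategory Y).2 _ _ _)).
by apply: bigsup_ub; exists (f z) => //; apply: (sub_up (vhom_vcategory Y)); exists z.
Qed.

Lemma hausdorff_map_continuous : continuous hausdorff_map.
Proof.
have fV := hom_vfunctor f.
have fo U : open U -> open (f @^-1` U).
  by move=> Uo; move/continuousP : (hom_continuous f); exact.
move=> A; apply: hausdorff_cvg => [|U Uo Ui|U Uo Ui].
- exact: (@fmap_filter _ _ _ _ (nbhs_filter A)).
- move=> [y [fAy Uy]]; suff [x Ax Ufx] : exists2 x, (A : set X) x & U (f x).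
    have : open (hit (f @^-1` U)).
      apply: hit_open; first exact: fo.
      exact: preimage_up_sub (vhom_vcategory X) fV Ui.
    rewrite openE => /(_ A) []; first by exists x.
    move=> N [? NA] NU; exists N => //; split => // B /NU [z [Bz Uz]].
    by exists (f z); split => //; apply: (sub_up (vhom_vcategory Y)); exists z.
  apply: contrapT => h; suff : (~` U) y by [].
  by rewrite Ui; apply: upS fAy => _ [x Ax <-] Ux; apply: h; exists x.
- move=> fAU; have : open (miss (f @^-1` U)).
  apply: miss_open; first exact: fo.
  exact: (preimage_up_sub (vcategory_op (vhom_vcategory X)) (fun x y => fV y x) Ui).
rewrite openE => /(_ A) []; first by move=> x Ax; apply: fAU; apply: (sub_up (vhom_vcategory Y)); exists x.
move=> N [? NA] NU; exists N => //; split => // B /NU BU y fBy.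
apply: contrapT => Uy.
have [_ [x Bx <-] fxy] := up_point (vcarrier_compact Y) (@vhom_closed Y) cd dir (image_closed (hset_closed B)) fBy.
suff : (~` U) (f x) by apply; exact: BU.
by rewrite Ui; exact: (@up_le _ _ _ (fun x y => vhom y x)) fxy.
Qed.

Definition hausdorff_mor : vcatch_hom (hausdorff_obj X) (hausdorff_obj Y) :=
  VCatCHHom hausdorff_map_continuous hausdorff_map_vfunctor.

End Morphism.

Lemma hausdorff_mor_id (X : vcatch V) :
  hausdorff_mor (vcatch_id X) = vcatch_id (hausdorff_obj X).
Proof.
apply: vcatch_hom_eq => A; apply: hausdorff_set_eq => /=.
by rewrite image_id -(hset_increasing A).
Qed.

Lemma hausdorff_mor_comp (X Y Z : vcatch V) (g : vcatch_hom Y Z)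
    (f : vcatch_hom X Y) :
  hausdorff_mor (vcatch_comp g f) = vcatch_comp (hausdorff_mor g) (hausdorff_mor f).
Proof.
have aZ := vhom_vcategory Z.
apply: vcatch_hom_eq => A; apply: hausdorff_set_eq; apply/seteqP; split => /=.
  apply: upS => _ [x Ax <-]; exists (f x) => //.
  by apply: (sub_up (vhom_vcategory Y)); exists x.
rewrite [X in _ `<=` X](up_increasing aZ); apply: upS => _ [y fAy <-].
apply: (le_trans fAy); apply: bigsup_image_le => _ [x Ax <-].
apply: (le_trans (hom_vfunctor g _ _)).
by apply: bigsup_ub; exists (g (f x)) => //; exists x.
Qed.

Definition hausdorff_functor : functor (VCatCHCategory V) (VCatCHCategory V) :=
  @Functor (VCatCHCategory V) (VCatCHCategory V)
    hausdorff_obj hausdorff_mor hausdorff_mor_id hausdorff_mor_comp.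

End HausdorffObject.

(* Main.v *)
Require Import Defs.
From mathcomp Require Import all_boot all_order.
From mathcomp Require Import all_classical topology.

(** Limits in V-CatCH are recognised pointwise: a cone c on a diagram D is a
    limit as soon as its legs p_j jointly separate points, every compatible
    family of points (z_j) comes from a point of the apex, and the structure of
    the apex is initial, that is a(x, y) = inf_j a_j(p_j x, p_j y)
    ([is_limit_intro]). The topology needs no separate condition: the apex is
    compact and the D_j are Hausdorff, so jointly injective continuous legs
    already determine convergence. Conversely a limit cone lifts compatible
    families ([is_limit_point], by probing it with the one-point object) and has
    the initial structure ([is_limit_hom], by probing it with its own apex
    carrying the initial structure).

    It remains to see that the legs of H c, which send A to the increasing hull
    of p_j(A), inherit these properties when the index set is codirected. All
    the content lies in two compactness arguments.

    - Initiality ([hausdorff_initial_hom]). If u is totally below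
      inf_j Ha_j(Hp_j A, Hp_j B) and y is in B, then each closed set of those x
      in A with u <= a_j(p_j x, p_j y) is nonempty. These sets form a codirected
      family, so by compactness one x in A serves all j, and
      u <= inf_j a_j(p_j x, p_j y) = a(x, y). Complete distributivity gives the
      inequality without u. Since k <= Ha(A, B) amounts to the inclusion of B in
      A, the separation of points follows ([hausdorff_jointly_injective]).

    - Lifting ([hausdorff_compatible]). A compatible family (A_j) is induced by
      the intersection of the preimages of the A_j. The point is that every y in
      A_i lies above p_i(x) for some x of this intersection: the closed sets of
      those x in A_j whose image in D_i is below y are nonempty and stable under
      the connecting maps, so they contain a compatible family, which comes from
      a point of the apex. That a codirected diagram of nonempty compact
      Hausdorff spaces has a compatible family of points is
      [compatible_point]. *)

Set Implicit Arguments.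
Unset Strict Implicit.
Unset Printing Implicit Defensive.

Import Order.TTheory.
Local Open Scope order_scope.
Local Open Scope classical_set_scope.

(** * Codirected index sets and compactness *)

Section Codirected.
Context {d : Order.disp_t} {I : porderType d}.

Lemma codirected_ultrafilter : codirected I ->
  exists G : ultrafilter I, forall l, uset G [set j | j <= l].
Proof.
move=> [[i0 _] dirI].
have [] := @ultraFilterLemma I
    (filter_from [set: I] (fun l => [set j | j <= l])).
  apply: filter_from_proper => [|l _]; last by exists l => /=.
  apply: filter_from_filter; first by exists i0.
  move=> i j _ _; have [l li lj] := dirI i j; exists l => // m /= ml.
  by split; exact: le_trans ml _.
by move=> G [UG sG]; exists (Ultrafilter UG) => l; apply: sG; exists l.
Qed.

Lemma codirected_closed_meet (X : topologicalType) (K : I -> set X) :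
  codirected I -> compact [set: X] ->
  (forall i, closed (K i)) -> (forall i, K i !=set0) ->
  (forall i j, i <= j -> K i `<=` K j) -> exists x, forall i, K i x.
Proof.
move=> [[i0 _] dirI] cX Kc K0 KS.
have PF : ProperFilter (filter_from [set: I] K).
  apply: filter_from_proper => [|i _]; last exact: K0.
  apply: filter_from_filter; first by exists i0.
  move=> i j _ _; have [l li lj] := dirI i j; exists l => // x Kx.
  by split; [exact: (KS _ _ li)|exact: (KS _ _ lj)].
have [x [_ xK]] := cX _ PF filterT.
by exists x => i; apply: Kc => B /(xK (K i)); apply; exists i.
Qed.

End Codirected.

(** * Limit cones of V-categorical compact Hausdorff spaces *)

Section Diagram.
Context {d : Order.disp_t} {V : quantaleType d}.

Lemma closed_vhom (T : topologicalType) (X : vcatch V) (f g : T -> X) v :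
  continuous f -> continuous g -> closed [set t | v <= vhom (f t) (g t)].
Proof.
move=> fC gC; have fgC : continuous (fun t => (f t, g t)).
  by move=> t; apply: cvg_pair; [exact: fC|exact: gC].
exact: (continuous_closedP _).1 fgC _ (vhom_closed (v := v)).
Qed.

Hypothesis cd : completely_distributive V.

(** The one-point space with hom k: its morphisms to X are the points of X,
    because k <= a(x, x). It is the free V-category on one point, which need not
    be terminal. *)
Definition point_hom (x y : discrete_topology unit) : V := qunit.

Lemma point_vcategory : is_vcategory point_hom.
Proof. by split => // *; rewrite /point_hom tensor1q. Qed.

Lemma point_compact : compact [set: discrete_topology unit].
Proof.
move=> F PF _; exists tt; split => // A B /filter_ex [[] Att] /nbhs_singleton.
by exists tt.
Qed.

Lemma point_hausdorff : hausdorff_space (discrete_topology unit).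
Proof. by move=> [] []. Qed.

Lemma point_vfunctor :
  is_vfunctor (uhat point_hom) point_hom (convergence point_compact).
Proof.
apply: vhom_closed_to => // v; have [vk|vk] := boolP (v <= qunit).
  by rewrite (_ : mkset _ = setT); [exact: closedT|apply/seteqP; split].
rewrite (_ : mkset _ = set0); first exact: closed0.
by apply/seteqP; split => // p /= h; move/negP: vk; apply.
Qed.

Definition point_obj : vcatch V :=
  VCatCH point_vcategory point_hausdorff point_vfunctor.

Definition point_mor (X : vcatch V) (x : X) : vcatch_hom point_obj X.
Proof.
refine (@VCatCHHom _ _ point_obj X (fun=> x) _ _).
- by move=> ?; exact: cvg_cst.
- by move=> ? ?; exact: (vhom_vcategory X).1.
Defined.

Context {d' : Order.disp_t} {I : porderType d'}.
Variable D : functor (poset_category I) (VCatCHCategory V).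

(** The components of diagrams and cones, retyped as objects and morphisms of
    V-CatCH so that their coercions to spaces and maps apply. *)
Definition diagram_obj (j : I) : vcatch V := D j.

Definition diagram_map i j (ij : i <= j) :
  vcatch_hom (diagram_obj i) (diagram_obj j) := @fmor _ _ D i j ij.

Definition cone_obj (c : cone D) : vcatch V := apex c.

Definition cone_map (c : cone D) j : vcatch_hom (cone_obj c) (diagram_obj j) :=
  leg c j.

Lemma diagram_map_comp i j l (ij : i <= j) (jl : j <= l) (il : i <= l) x :
  diagram_map il x = diagram_map jl (diagram_map ij x).
Proof.
rewrite (bool_irrelevance il (le_trans ij jl)).
rewrite -[le_trans _ _]/(@Defs.comp (poset_category I) i j l jl ij).
by rewrite /diagram_map fmor_comp.
Qed.

Lemma cone_map_natural c i j (ij : i <= j) x :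
  diagram_map ij (cone_map c i x) = cone_map c j x.
Proof. by rewrite /cone_map -(@leg_natural _ _ _ c i j ij). Qed.

Lemma cone_mor_apply (c c' : cone D)
    (h : vcatch_hom (cone_obj c') (cone_obj c)) :
  (forall j, @Defs.comp (VCatCHCategory V) _ _ _ (leg c j) h = leg c' j) ->
  forall j y, cone_map c j (h y) = cone_map c' j y.
Proof.
move=> hE j y.
exact: (congr1
  (fun g : vcatch_hom (cone_obj c') (diagram_obj j) => g y) (hE j)).
Qed.

Definition compatible (z : forall j, diagram_obj j) :=
  forall i j (ij : i <= j), diagram_map ij (z i) = z j.

Definition pointwise_cone (X : vcatch V)
    (f : forall j, vcatch_hom X (diagram_obj j))
    (fN : forall i j (ij : i <= j) x, diagram_map ij (f i x) = f j x) :
  cone D.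
Proof.
refine (@Cone (poset_category I) (VCatCHCategory V) D X f _).
by move=> i j ij; apply: vcatch_hom_eq => x; exact: fN.
Defined.

(** A compatible family of points is a cone with the one-point object as apex;
    the point sought is the image of the mediating morphism. *)
Lemma is_limit_point c z : is_limit c -> compatible z ->
  exists x, forall j, cone_map c j x = z j.
Proof.
move=> cL zC; pose p := @pointwise_cone point_obj (fun j => point_mor (z j))
  (fun i j ij _ => zC i j ij).
have [h [hp _]] := cL p.
exists ((h : vcatch_hom (cone_obj p) (cone_obj c)) tt) => j.
exact: (cone_mor_apply hp).
Qed.

Section Initial.
Variable c : cone D.
Let X := cone_obj c.

(** The largest V-category structure on the apex for which all legs are
    V-functors. *)
Definition initial_hom (x y : X) : V :=
  biginf [set vhom (cone_map c j x) (cone_map c j y) | j in [set: I]].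

Lemma initial_hom_le j x y :
  initial_hom x y <= vhom (cone_map c j x) (cone_map c j y).
Proof.
exact: (biginf_image_lb (fun j => vhom (cone_map c j _) (cone_map c j _))).
Qed.

Lemma initial_vcategory : is_vcategory initial_hom.
Proof.
split=> [x|x y z]; apply: biginf_image_ge => j _.
  exact: (vhom_vcategory _).1.
apply: le_trans ((vhom_vcategory _).2 _ (cone_map c j y) _).
by apply: tensor_le2; exact: initial_hom_le.
Qed.

Lemma initial_vfunctor : is_vfunctor (uhat initial_hom) initial_hom
  (convergence (vcarrier_compact X)).
Proof.
apply: vhom_closed_to => // v.
rewrite (_ : mkset _ = \bigcap_(j in [set: I])
    [set p : X * X | v <= vhom (cone_map c j p.1) (cone_map c j p.2)]).
  apply: closed_bigI => j _.
  apply: (@closed_vhom (X * X)%type _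
    (cone_map c j \o fst) (cone_map c j \o snd)) => p.
    by apply: continuous_comp; [exact: cvg_fst|exact: hom_continuous].
  by apply: continuous_comp; [exact: cvg_snd|exact: hom_continuous].
apply/seteqP; split => p /= h.
  by move=> j _ /=; apply: (le_trans h); exact: initial_hom_le.
by apply: biginf_image_ge => j _; exact: h.
Qed.

Definition initial_obj : vcatch V :=
  VCatCH initial_vcategory (vcarrier_hausdorff X) initial_vfunctor.

Definition initial_leg j : vcatch_hom initial_obj (diagram_obj j).
Proof.
refine (@VCatCHHom _ _ initial_obj _ (cone_map c j)
  (hom_continuous (cone_map c j)) _).
by move=> x y; exact: initial_hom_le.
Defined.

Definition initial_refine : vcatch_hom X initial_obj.
Proof.
refine (@VCatCHHom _ _ X initial_obj id _ _); first by move=> x; exact: cvg_id.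
by move=> x y; apply: biginf_image_ge => j _; exact: hom_vfunctor.
Defined.

(** The apex with the initial structure is a cone as well, so there is a
    mediating morphism h from it to the apex. Composed with the identity map,
    which refines the original structure to the initial one, h commutes with the
    legs; hence h is the identity map, and as a V-functor out of the initial structure
    it gives the inequality. *)
Lemma is_limit_hom x y : is_limit c -> initial_hom x y <= vhom x y.
Proof.
move=> cL.
have [h [hp _]] := cL (pointwise_cone (f := initial_leg) (@cone_map_natural c)).
have [e [_ eU]] := cL c.
have hid : vcatch_comp h initial_refine = vcatch_id X.
  transitivity e.
    symmetry; apply: eU => j; apply: vcatch_hom_eq => t.
    exact: (cone_mor_apply hp).
  by apply: eU => j; exact: comp_idr.
have hE t : (h : vcatch_hom initial_obj X) t = t.
  exact: (congr1 (fun g : vcatch_hom X X => g t) hid).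
by have := hom_vfunctor (h : vcatch_hom initial_obj X) x y; rewrite !hE.
Qed.

End Initial.

(** The mediating map h is forced pointwise, and initiality makes it a
    V-functor. For its continuity, let an ultrafilter F converge to y. By
    compactness its image under h has a limit x, and each leg sends both x and
    h y to the limit of F along the leg of the other cone; thus x = h y. *)
Lemma is_limit_intro c :
  (forall x y, (forall j, cone_map c j x = cone_map c j y) -> x = y) ->
  (forall x y : cone_obj c, initial_hom x y <= vhom x y) ->
  (forall z, compatible z -> exists x, forall j, cone_map c j x = z j) ->
  is_limit c.
Proof.
move=> cI cH cS c'.
have /choice[h hE] : forall y : cone_obj c',
    exists x, forall j, cone_map c j x = cone_map c' j y.
  by move=> y; apply: cS => i j ij; exact: cone_map_natural.
have hV : is_vfunctor vhom vhom h.
  move=> y y'; apply: le_trans (cH _ _); apply: biginf_image_ge => j _.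
  by rewrite !hE; exact: hom_vfunctor.
have hC : continuous h.
  apply/continuous_closedP => A Ac; apply: closed_ultraP => F y FA Fy.
  pose x := convergence (vcarrier_compact (cone_obj c)) (umap h F).
  have hFx : uset (umap h F) --> x by exact: convergenceP.
  have Ax : A x.
    apply: Ac => B /hFx hB; have UF := usetP F.
    have [t [At Bt]] :=
      @filter_ex _ (uset F) _ _ (@filterI _ (uset F) _ _ _ FA hB).
    by exists (h t).
  suff xh : x = h y by rewrite xh in Ax.
  apply: cI => j; rewrite hE.
  have lim t : uset (umap (cone_map c' j) F) --> t ->
      convergence (vcarrier_compact (diagram_obj j))
        (umap (cone_map c' j) F) = t.
    by move=> Ft; apply: convergence_eq Ft; exact: vcarrier_hausdorff.
  rewrite -(lim (cone_map c' j y)); last first.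
    by move=> B By; apply: Fy; exact: (hom_continuous (cone_map c' j) y B By).
  symmetry; apply: lim => B Bx; have UF := usetP F.
  have := hFx _ (hom_continuous (cone_map c j) x B Bx).
  by apply: (@filterS _ (uset F)) => t /=; rewrite hE.
exists (VCatCHHom hC hV); split => [j|g gE].
  by apply: vcatch_hom_eq => y /=; exact: hE.
apply: vcatch_hom_eq => y /=; apply: cI => j; rewrite hE.
exact/esym/(cone_mor_apply gE).
Qed.

(** Fix an ultrafilter G on the index set that contains all down-sets, and
    choose x_j in K_j for each j. For fixed l, the points obtained by mapping x_j
    to D_l are defined for G-almost all j, so they converge along G to some z_l.
    As the connecting maps are continuous, these limits are compatible, and z_l
    lies in K_l because K_l is closed. This replaces Tychonoff's theorem for the
    product of the D_j. *)
Lemma compatible_point (K : forall j, set (diagram_obj j)) : codirected I ->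
  (forall j, closed (K j)) -> (forall j, K j !=set0) ->
  (forall i j (ij : i <= j) x, K i x -> K j (diagram_map ij x)) ->
  exists z, compatible z /\ forall j, K j (z j).
Proof.
move=> dirI Kc K0 KS.
have [G Gd] := codirected_ultrafilter dirI; have UG := usetP G.
pose x j := sval (cid (K0 j)).
have Kx j : K j (x j) by exact: svalP (cid (K0 j)).
(* The value outside of the down-set of l is immaterial: G contains that set. *)
have tP l j : exists t, forall jl : j <= l, t = diagram_map jl (x j).
  have [jl|njl] := pselect (j <= l); last by exists (x l).
  by exists (diagram_map jl (x j)) => jl'; rewrite (bool_irrelevance jl jl').
pose t l j := sval (cid (tP l j)).
have tE l j (jl : j <= l) : t l j = diagram_map jl (x j).
  exact: svalP (cid (tP l j)) jl.
pose z l :=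
  convergence (vcarrier_compact (diagram_obj l)) (umap (t l) G).
have tz l : uset (umap (t l) G) --> z l by exact: convergenceP.
exists z; split => [i j ij|l].
  symmetry; apply: convergence_eq; first exact: vcarrier_hausdorff.
  move=> B Bz; rewrite /= /fmap /=.
  have /tz tB := hom_continuous (diagram_map ij) (z i) B Bz.
  apply: (@filterS _ (uset G) _ _ _ _ (@filterI _ (uset G) _ _ _ (Gd i) tB)).
  move=> m [/= mi]; rewrite (tE _ _ mi) (tE _ _ (le_trans mi ij)).
  by rewrite (diagram_map_comp mi ij).
apply: (Kc l (z l)) => B /tz tB.
have [m [/= ml Bm]] :=
  @filter_ex _ (uset G) _ _ (@filterI _ (uset G) _ _ _ (Gd l) tB).
by exists (t l m); split => //; rewrite (tE _ _ ml); apply: KS.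
Qed.

End Diagram.

(** * The image of a limit cone under the Hausdorff functor *)

Section HausdorffLimit.
Context {d : Order.disp_t} {V : quantaleType d}.
Hypothesis cd : completely_distributive V.
Hypothesis dir : directed [set u : V | totally_below u qunit].

Lemma hausdorff_hom_ge (X : vcatch V) (A B : hausdorff_obj cd dir X) :
  qunit <= vhom A B -> (B : set X) `<=` A.
Proof.
move=> AB y By; rewrite (hset_increasing A).
apply: (le_trans AB).
exact: (biginf_image_lb (fun y => bigsup [set vhom x y | x in (A : set X)])).
Qed.

Context {d' : Order.disp_t} {I : porderType d'}.
Variables (D : functor (poset_category I) (VCatCHCategory V)) (c : cone D).
Hypotheses (dirI : codirected I) (cL : is_limit c).
Let H := hausdorff_functor cd dir.
Let Hc := cone_image H c.

(** The reverse of the inequality stating that H c consists of V-functors. The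
    witness x in A must not depend on the index, which is where compactness of A
    and codirectedness come in. *)
Lemma hausdorff_initial_hom (A B : cone_obj Hc) : initial_hom A B <= vhom A B.
Proof.
apply: biginf_image_ge => y By; apply: cd_le => // u uv.
pose K j := [set x : cone_obj c | (A : set (cone_obj c)) x /\
  u <= vhom (cone_map c j x) (cone_map c j y)].
have [|||x Kx] :=
    @codirected_closed_meet _ _ _ K dirI (vcarrier_compact (cone_obj c)).
- move=> j; apply: closedI; first exact: (hset_closed A).
  apply: closed_vhom; first exact: hom_continuous.
  by move=> x; exact: cvg_cst.
- move=> j.
  pose fA := cone_map c j @` (A : set (cone_obj c)).
  have /(totally_below_lew uv) :
      initial_hom A B <= bigsup [set vhom x (cone_map c j y) | x in fA].
    apply: (le_trans (initial_hom_le j A B)).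
    (* The leg of H c sends A to the increasing hull of fA. *)
    apply: le_trans (bigsup_up (vhom_vcategory (diagram_obj D j)) fA _).
    apply: (biginf_image_lb (fun z => bigsup [set vhom x z | x in up vhom fA])).
    by apply: (sub_up (vhom_vcategory (diagram_obj D j))); exists y.
  move=> /(_ _ (lexx _)) [_ [_ [x Ax <-] <-] ux].
  by exists x.
- move=> i j ij x [Ax ux]; split => //; apply: (le_trans ux).
  by rewrite -!(cone_map_natural ij); exact: hom_vfunctor.
have [i0 _] := dirI.1.
apply: le_trans (bigsup_image_ub (fun x => vhom x y) (Kx i0).1).
apply: le_trans (is_limit_hom cd x y cL).
by apply: biginf_image_ge => j _; exact: (Kx j).2.
Qed.

Lemma hausdorff_jointly_injective (A B : cone_obj Hc) :
  (forall j, cone_map Hc j A = cone_map Hc j B) -> A = B.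
Proof.
move=> AB; have Hk (A' B' : cone_obj Hc) :
    (forall j, cone_map Hc j A' = cone_map Hc j B') -> qunit <= vhom A' B'.
  move=> AB'; apply: le_trans (hausdorff_initial_hom _ _).
  apply: biginf_image_ge => j _; rewrite AB'.
  exact: (vhom_vcategory (diagram_obj _ j)).1.
apply: hausdorff_set_eq; apply/seteqP; split.
  by apply: hausdorff_hom_ge; apply: Hk => j; rewrite AB.
by apply: hausdorff_hom_ge; exact: Hk.
Qed.

(** The preimage of an increasing set under a V-functor is increasing, so the
    intersection of the preimages is a point of H X, and the increasing hull of
    its image in D_i is contained in A_i. The reverse inclusion is the lifting
    described at the top. *)
Lemma hausdorff_compatible (A : forall j, diagram_obj (functor_comp H D) j) :
  compatible A -> exists B, forall j, cone_map Hc j B = A j.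
Proof.
move=> AC; pose X := cone_obj c.
have AS i j (ij : i <= j) (x : diagram_obj D i) :
    (A i : set _) x -> (A j : set _) (diagram_map D ij x).
  move=> Ax; rewrite -(AC i j ij).
  by apply: (sub_up (vhom_vcategory (diagram_obj D j))); exists x.
pose B0 : set X := \bigcap_(j in [set: I]) (cone_map c j @^-1` (A j : set _)).
have B0c : closed B0.
  apply: closed_bigI => j _.
  exact: (continuous_closedP _).1 (hom_continuous (cone_map c j)) _
    (hset_closed (A j)).
have B0i : increasing vhom B0.
  apply/seteqP; split; first exact: (sub_up (vhom_vcategory X)).
  move=> x B0x j _.
  rewrite (preimage_up_sub (vhom_vcategory X) (hom_vfunctor (cone_map c j))
    (hset_increasing (A j))).
  by apply: upS B0x => t; apply.
exists (HausdorffSet B0c B0i) => i.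
apply: hausdorff_set_eq; apply/seteqP; split.
  rewrite [X in _ `<=` X](hset_increasing (A i)); apply: upS => _ [x B0x <-].
  exact: B0x.
move=> y Ay.
(* The order condition is empty for j not below i, so that K is a family on
   the whole diagram. *)
pose K j := [set x : diagram_obj D j | (A j : set _) x /\
  forall ji : j <= i, qunit <= vhom (diagram_map D ji x) y].
have [|||z [zC zK]] := @compatible_point _ _ _ _ D K dirI.
- move=> j; rewrite (_ : K j = (A j : set _) `&` \bigcap_(ji in [set: j <= i])
     [set x | qunit <= vhom (diagram_map D ji x) y]).
    apply: closedI; first exact: (hset_closed (A j)).
    apply: closed_bigI => ji _.
    apply: closed_vhom; first exact: hom_continuous.
    by move=> x; exact: cvg_cst.
  by apply/seteqP; split => x [Ax h]; split => // ji; [move=> _|]; exact: h.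
- (* For l below both i and j, any point of A l whose image in D i is below y
     is sent into K j. *)
  move=> j; have [l li lj] := dirI.2 i j.
  have fAc : closed (diagram_map D li @` (A l : set (diagram_obj D l))).
    by apply: image_closed; exact: (hset_closed (A l)).
  have : up vhom (diagram_map D li @` (A l : set (diagram_obj D l))) y.
    by move: Ay; rewrite -(AC l i li).
  move=> /(up_point (vcarrier_compact _) (@vhom_closed _ _ _) cd dir fAc).
  move=> [_ [x Ax <-] xy]; exists (diagram_map D lj x); split; first exact: AS.
  by move=> ji; rewrite -(diagram_map_comp lj ji li).
- move=> j l jl x [Ax xy]; split; first exact: AS.
  move=> li; rewrite -(diagram_map_comp jl li (le_trans jl li)); exact: xy.
have [x xz] := is_limit_point cd cL zC.
have B0x : B0 x by move=> j _ /=; rewrite xz; exact: (zK j).1.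
apply: (@up_le _ _ _ _ _ (cone_map c i x)); first by exists x.
by rewrite xz -(zC i i (lexx i)); exact: (zK i).2.
Qed.

End HausdorffLimit.

Theorem theorem4p34 (d : Order.disp_t) (V : quantaleType d)
    (cd : completely_distributive V)
    (dir : directed [set u : V | totally_below u qunit]) :
  preserves_codirected_limits (hausdorff_functor cd dir).
Proof.
move=> d' I D c dirI cL; apply: is_limit_intro.
- exact: hausdorff_jointly_injective.
- exact: hausdorff_initial_hom.
- exact: hausdorff_compatible.
Qed.
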